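(* Let $\{a_i\}_{i\in\mathbb{N}}$ be a non-zero sequence of complex numbers, not necessarily periodic. For every $n\geq 2$, the product $$C_n=\prod_{i=0}^{n-1}\begin{bmatrix} a_{n-1-i} & 1\\ 1 & 0\end{bmatrix}=A_{n-1}A_{n-2}\cdots A_1A_0,\qquad A_i=\begin{bmatrix} a_i & 1\\ 1& 0\end{bmatrix},$$ is given by $$C_n=\begin{bmatrix} \Omega_n(1,\mathfrak{a}_{0,n-1}) & \Omega_{n-1}(1,\mathfrak{a}_{1,n-1})\\ \Omega_{n-1}(1,\mathfrak{a}_{0,n-2}) & \Omega_{n-2}(1,\mathfrak{a}_{1,n-2})\end{bmatrix},$$ where $\Omega_m(1,\cdot)$ denotes the value at $t=1$ of the formal polynomial $\Omega_m(t,\cdot)\in\mathbb{C}[t]$ defined in the context.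
   Context: $\mathbb{N}=\{0,1,2,\ldots\}$. A ''non-zero sequence'' means a sequence that is not identically zero; individual terms may vanish. For $i\le j$ write $\mathfrak{a}_{i,j}=(a_i,a_{i+1},\ldots,a_j)^T$, with $\mathfrak{a}_{i,i}=\mathfrak{a}_i=a_i$. Usual conventions on sums and products apply (empty product $=1$, empty sum $=0$). Let $n,p$ be positive integers of the same parity with $p\le n$. The symbol $\widehat{\sum}_{i_0,\ldots,i_{p-1}}^{n,p}$ denotes the $p$-fold nested sum over integers $i_0,\ldots,i_{p-1}$ with the following ranges: $0\le i_0\le \frac{n-p}{2}$; $i_{2m-1}+1\le i_{2m}\le \frac{n-p}{2}+m$ for each $m\ge 1$ with $2m\le p-1$; and $i_{2m}\le i_{2m+1}\le \frac{n-p}{2}+m$ for each $m\ge 0$ with $2m+1\le p-1$. (The upper bound of the innermost sum is $\frac{n-2}{2}$ if $n,p$ are even and $\frac{n-1}{2}$ if $n,p$ are odd.) For $L\in\mathbb{N}$, define the complex number $\chi_{n,p}(\mathfrak{a}_{L,L+n-1})$ as follows. If $n$ and $p$ are even, $0<p\le n$: $$\chi_{n,p}(\mathfrak{a}_{L,L+n-1})=\widehat{\sum_{i_0,\ldots,i_{p-1}}^{n,p}}\ \prod_{l=0}^{\frac p2-1}a_{L+2i_{2l}}\ \prod_{l=0}^{\frac p2-1}a_{L+1+2i_{2l+1}}.$$ For $n$ even and $p=0$, $\chi_{n,0}(v)=1$ for any vector $v$ (including $n=0$ with the empty vector). If $n$ and $p$ are odd, $1\le p\le n$: $$\chi_{n,p}(\mathfrak{a}_{L,L+n-1})=\widehat{\sum_{i_0,\ldots,i_{p-1}}^{n,p}}\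 \prod_{l=0}^{\frac{p-1}2}a_{L+2i_{2l}}\ \prod_{l=0}^{\frac{p-1}2-1}a_{L+1+2i_{2l+1}}.$$ For $n\ge 0$ and $L\in\mathbb{N}$ define $$\Omega_n(t,\mathfrak{a}_{L,L+n-1})=\begin{cases}\displaystyle\sum_{j=0}^{n/2}\chi_{n,2j}(\mathfrak{a}_{L,L+n-1})\,t^{2j}, & n\text{ even},\\[2mm] \displaystyle\sum_{j=0}^{(n-1)/2}\chi_{n,2j+1}(\mathfrak{a}_{L,L+n-1})\,t^{2j+1}, & n\text{ odd}.\end{cases}$$ In particular $\Omega_0(t)=1$ (with the empty vector, e.g. $\mathfrak{a}_{1,0}$). *)

(* Defs.v *)
From HB Require Import structures.
From mathcomp Require Import all_boot all_order all_algebra.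
From mathcomp Require Import complex reals.
Set Implicit Arguments.
Unset Strict Implicit.
Unset Printing Implicit Defensive.
Import Order.TTheory GRing.Theory Num.Theory.
Local Open Scope ring_scope.

Section Definitions.
Variable K : comNzRingType.

Definition mx22 (x y z w : K) : 'M[K]_2 :=
  \matrix_(i, j) nth 0 (nth [::] [:: [:: x; y]; [:: z; w]] i) j.

(* The vector (a_L, ..., a_(L+n-1)), indexed by its start and its length, so  *)
(* that n = 0 gives the empty vector.                                         *)
Definition segment (a : nat -> K) (L n : nat) : n.-tuple K :=
  [tuple a (L + k)%N | k < n].

(* Ranges of the index i_k of the hatted sum, where prev = i_(k-1):           *)
(*   0 <= i_0,  i_(2m-1) + 1 <= i_(2m),  i_(2m) <= i_(2m+1),                  *)
(* and i_(2m), i_(2m+1) <= (n - p)/2 + m.                                     *)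
Definition hat_lower (k prev : nat) : nat :=
  if k == 0%N then 0%N else if odd k then prev else prev.+1.

Definition hat_upper (n p k : nat) : nat := ((n - p)./2 + k./2)%N.

(* The sums over the r indices that follow i_0, ..., i_(size s - 1), the      *)
(* latter being already bound to the entries of s.                            *)
Fixpoint hat_sum_rec (n p r : nat) (s : seq nat) (F : seq nat -> K) : K :=
  if r is r'.+1 then
    \sum_(hat_lower (size s) (last 0%N s) <= j < (hat_upper n p (size s)).+1)
      hat_sum_rec n p r' (rcons s j) F
  else F s.

Definition hat_sum (n p : nat) (F : seq nat -> K) : K :=
  hat_sum_rec n p p [::] F.

(* Only meaningful for p <= n of the same parity. There are uphalf p indices  *)
(* of even rank and p./2 of odd rank, which covers both parities; entry k of  *)
(* v = segment a L n is a_(L+k), and all entries accessed have k < n.         *)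
Definition chi (n p : nat) (v : n.-tuple K) : K :=
  if p == 0%N then 1 else
  hat_sum n p (fun i =>
    (\prod_(0 <= l < uphalf p) v`_(2 * nth 0%N i (2 * l))) *
    (\prod_(0 <= l < p./2) v`_(1 + 2 * nth 0%N i (2 * l + 1)))).

Definition Omega (n : nat) (v : n.-tuple K) : {poly K} :=
  if odd n then
    \sum_(0 <= j < (n.-1)./2.+1) chi (2 * j + 1) v *: 'X^(2 * j + 1)
  else
    \sum_(0 <= j < n./2.+1) chi (2 * j) v *: 'X^(2 * j).

End Definitions.

(* Main.v *)
Require Import Defs.
From HB Require Import structures.
From mathcomp Require Import all_boot all_order all_algebra.
From mathcomp Require Import complex reals.
From mathcomp Require Import zify ring.
Set Implicit Arguments.
Unset Strict Implicit.
Unset Printing Implicit Defensive.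
Import Order.TTheory GRing.Theory Num.Theory.
Local Open Scope ring_scope.

(** By Euler's rule, the continuant of a_L, ..., a_(L+n-1) is the sum of the
    products that remain after deleting disjoint pairs of adjacent letters from
    the word a_L ... a_(L+n-1).  The gaps between the surviving letters then
    have even length, so the survivors sit at offsets k_0 < k_1 < ... <
    k_(p-1) with k_j of the parity of j and p of the parity of n.  The hatted
    sum ranges exactly over these offsets, written k_(2m) = 2 i_(2m) and
    k_(2m+1) = 2 i_(2m+1) + 1; hence chi_(n,p) collects the terms with p
    surviving letters, and Omega_n at t = 1 is the whole continuant.

    The bridge is [gap_sum]: when r letters are still to be kept and w pairs
    still to be deleted, the next kept letter is preceded by some d <= w deleted
    pairs.  The bounds on i_k say just this, as the difference between the upper
    and lower bounds of i_k is the number of pairs left ([hat_sum_rec_gap]).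
    Splitting by whether the first letter is kept ([gap_sumSS]) gives
    Euler's recurrence K_(n+2)(L) = a_L K_(n+1)(L+1) + K_n(L+2)
    ([continuantSS]), which is also what right multiplication by A_L does to
    the entries of the matrix product ([prod_mx22_continuant]). *)

Section Continuant.
Variable K : comNzRingType.
Implicit Types (f g a : nat -> K).

(** The sum of the products of [r] letters of the word
    f b, ..., f (b + 2w + r - 1) that survive the deletion of [w] disjoint
    adjacent pairs. *)
Fixpoint gap_sum f (r w b : nat) : K :=
  if r is r'.+1 then
    \sum_(0 <= d < w.+1) f (b + 2 * d)%N * gap_sum f r' (w - d) (b + 2 * d).+1
  else 1.

Lemma eq_gap_sum f g r w b c :
    (forall k, (k < 2 * w + r)%N -> f (b + k)%N = g (c + k)%N) ->
  gap_sum f r w b = gap_sum g r w c.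
Proof.
elim: r w b c => [//|r IHr] w b c eq_fg /=.
apply: eq_big_nat => d /andP[_ d_lt].
rewrite eq_fg; last by lia.
congr (_ * _); apply: IHr => k k_lt.
have := eq_fg (2 * d + k.+1)%N; rewrite -!addnS -!addnA addSnnS; apply; lia.
Qed.

Lemma gap_sumS0 f r b : gap_sum f r.+1 0 b = f b * gap_sum f r 0 b.+1.
Proof. by rewrite /= big_nat1 muln0 addn0. Qed.

(** The first term of the sum keeps the first letter; the other terms delete
    the first two letters. *)
Lemma gap_sumSS f r w b :
  gap_sum f r.+1 w.+1 b =
  f b * gap_sum f r w.+1 b.+1 + gap_sum f r.+1 w b.+2.
Proof.
rewrite /= big_nat_recl // muln0 addn0 subn0; congr (_ + _).
apply: eq_bigr => d _; rewrite subSS.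
by have -> : (b + 2 * d.+1 = b.+2 + 2 * d)%N by lia.
Qed.

(** Euler's rule for the continuant of a L, ..., a (L + n - 1), sorted by the
    number [w] of deleted pairs. *)
Definition continuant a (n L : nat) : K :=
  \sum_(0 <= w < n./2.+1) gap_sum a (n - 2 * w) w L.

Lemma continuant0 a L : continuant a 0 L = 1.
Proof. by rewrite /continuant big_nat1. Qed.

Lemma continuant1 a L : continuant a 1 L = a L.
Proof. by rewrite /continuant big_nat1 gap_sumS0 mulr1. Qed.

Lemma continuantSS a n L :
  continuant a n.+2 L = a L * continuant a n.+1 L.+1 + continuant a n L.+2.
Proof.
(* Deleting every letter needs n even, and is the one term in which the first
   letter cannot be kept: then the sum for n.+1 is a term shorter. *)
have tail_sum : \sum_(0 <= w < n./2.+1) gap_sum a (n - 2 * w) w.+1 L =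
    a L * (\sum_(0 <= w < (n.+1)./2) gap_sum a (n - (2 * w).+1) w.+1 L.+1)
    + continuant a n L.+2.
  rewrite /continuant mulr_sumr.
  have step w : (2 * w < n)%N -> gap_sum a (n - 2 * w) w.+1 L =
      a L * gap_sum a (n - (2 * w).+1) w.+1 L.+1 + gap_sum a (n - 2 * w) w L.+2.
    move=> w_lt; have -> : (n - 2 * w = (n - (2 * w).+1).+1)%N by lia.
    exact: gap_sumSS.
  have [n_odd | n_even] := boolP (odd n).
    have -> : ((n.+1)./2 = n./2.+1)%N by lia.
    by rewrite -big_split /=; apply: eq_big_nat => w w_lt; apply: step; lia.
  have -> : ((n.+1)./2 = n./2)%N by lia.
  rewrite !(big_nat_recr n./2) //= addrA.
  have -> : (n - 2 * n./2 = 0)%N by lia.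
  congr (_ + _); rewrite -big_split /=.
  by apply: eq_big_nat => w w_lt; apply: step; lia.
have head m c : continuant a m c =
    gap_sum a m 0 c + \sum_(0 <= w < m./2) gap_sum a (m - 2 * w.+1) w.+1 c.
  by rewrite /continuant big_nat_recl // muln0 subn0.
rewrite (head n.+2) (head n.+1) gap_sumS0 mulrDr -addrA; congr (_ + _).
transitivity (\sum_(0 <= w < n./2.+1) gap_sum a (n - 2 * w) w.+1 L).
  apply: eq_big_nat => w _; congr gap_sum; lia.
rewrite tail_sum; congr (_ * _ + _).
apply: eq_big_nat => w _; congr gap_sum; lia.
Qed.

Lemma mulmx22 (x y z w x' y' z' w' : K) :
  mx22 x y z w * mx22 x' y' z' w' =
  mx22 (x * x' + y * z') (x * y' + y * w')
       (z * x' + w * z') (z * y' + w * w').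
Proof.
apply/matrixP => i j; rewrite !mxE !big_ord_recl big_ord0 addr0 !mxE.
by case: i => [[|[|//]] ?]; case: j => [[|[|//]] ?].
Qed.

Lemma prod_mx22_continuant a m L :
  \prod_(i < m.+2) mx22 (a (L + (m.+1 - i))%N) 1 1 0 =
  mx22 (continuant a m.+2 L) (continuant a m.+1 L.+1)
       (continuant a m.+1 L) (continuant a m L.+1).
Proof.
elim: m L => [|m IHm] L.
  rewrite !big_ord_recl big_ord0 mulr1 mulmx22 /= !subn0 addn1 addn0.
  by rewrite continuantSS !continuant1 !continuant0; congr mx22; ring.
rewrite big_ord_recr /= subnn addn0.
under eq_bigr => i _.
  have -> : (L + (m.+2 - i) = L.+1 + (m.+1 - i))%N by move: (ltn_ord i); lia.
  over.
rewrite IHm mulmx22 !mulr1 !mulr0 !addr0.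
rewrite (continuantSS a m.+1 L) (continuantSS a m L).
by congr mx22; rewrite mulrC.
Qed.

Lemma prod_nat_parity (F : nat -> K) p :
  \prod_(0 <= k < p) F k =
  (\prod_(0 <= l < uphalf p) F (2 * l)%N) *
  (\prod_(0 <= l < p./2) F (2 * l + 1)%N).
Proof.
elim: p => [|p IHp]; first by rewrite !big_nil mulr1.
rewrite big_nat_recr //= IHp.
have [p_odd | p_even] := boolP (odd p).
  have -> : (uphalf p = p./2.+1)%N by lia.
  rewrite [X in _ = _ * X]big_nat_recr //= mulrA.
  by congr (_ * _ * F _); lia.
have -> : (uphalf p = p./2)%N by lia.
rewrite [X in _ = X * _]big_nat_recr //= mulrAC.
by congr (_ * F _ * _); lia.
Qed.

(** The slack [w] between the two bounds of i_k is the number of pairs left to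
    delete: i_k = lower + d skips d pairs, and leaves the slack w - d for
    i_(k+1), whatever the parity of k. *)
Lemma hat_sum_rec_gap f n p r w s (F : seq nat -> K) :
    (forall i, size i = p ->
       F i = \prod_(0 <= k < p) f (odd k + 2 * nth 0%N i k)%N) ->
    (size s + r = p)%N ->
    (hat_lower (size s) (last 0%N s) + w = hat_upper n p (size s))%N ->
  hat_sum_rec n p r s F =
  (\prod_(0 <= k < size s) f (odd k + 2 * nth 0%N s k)%N) *
  gap_sum f r w (odd (size s) + 2 * hat_lower (size s) (last 0%N s)).
Proof.
move=> F_prod; elim: r w s => [|r IHr] w s size_s slack /=.
  by rewrite addn0 in size_s; rewrite mulr1 F_prod // -size_s.
set k := size s in size_s slack *.
set lo := hat_lower k _ in slack *.
rewrite -slack mulr_sumr -[X in \sum_(X <= _ < _) _]add0n big_addn.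
have -> : ((lo + w).+1 - lo = w.+1)%N by lia.
apply: eq_big_nat => d /andP[_ d_lt].
have next_lo : hat_lower k.+1 (d + lo) = (odd k + (d + lo))%N.
  by rewrite /hat_lower /=; case: (odd k).
rewrite (IHr (w - d)%N); rewrite ?size_rcons ?last_rcons -/k ?next_lo.
- rewrite big_nat_recr //= nth_rcons ltnn eqxx mulrA; congr (_ * _ * _).
  + by apply: eq_big_nat => l /andP[_ l_lt]; rewrite nth_rcons l_lt.
  + by congr f; lia.
  + by congr gap_sum; case: (odd k) => /=; lia.
- by rewrite addSnnS.
- by move: slack; rewrite /hat_upper; lia.
Qed.

Lemma chi_gap_sum a L n p :
  (p <= n)%N -> ~~ odd (n - p) ->
  chi p (segment a L n) = gap_sum a p (n - p)./2 L.
Proof.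
move=> p_le np_even; rewrite /chi; case: eqP => [-> //|_].
rewrite /hat_sum (@hat_sum_rec_gap (nth 0 (segment a L n)) n p p (n - p)./2) //=.
- rewrite big_nil mul1r; apply: eq_gap_sum => k k_lt.
  have k_lt_n : (k < n)%N by lia.
  by exact: (nth_mktuple (fun k : 'I_n => a (L + k)%N) 0 (Ordinal k_lt_n)).
- move=> i _; rewrite [RHS]prod_nat_parity; congr (_ * _); apply: eq_bigr => l _.
  + by congr nth; lia.
  + by congr nth; lia.
- by rewrite /hat_upper addn0.
Qed.

Lemma Omega_continuant a L n :
  (Omega (segment a L n)).[1] = continuant a n L.
Proof.
have eval e :
    (\sum_(0 <= j < n./2.+1) chi (2 * j + e) (segment a L n)
       *: 'X^(2 * j + e)).[1] =
    \sum_(0 <= j < n./2.+1) chi (2 * j + e) (segment a L n).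
  rewrite horner_sum; apply: eq_bigr => j _.
  by rewrite hornerZ hornerXn expr1n mulr1.
transitivity (\sum_(0 <= j < n./2.+1) chi (2 * j + odd n) (segment a L n)).
  rewrite -eval /Omega; case: ifP => n_odd.
    by have -> : ((n.-1)./2 = n./2)%N by lia.
  by under [in RHS]eq_bigr do rewrite addn0.
(* keeping 2 j + odd n letters amounts to deleting n./2 - j pairs *)
rewrite /continuant big_nat_rev /=; apply: eq_big_nat => w w_lt.
by rewrite chi_gap_sum; try lia; congr gap_sum; lia.
Qed.

End Continuant.

Theorem theorem2p10 (R : realType) (a : nat -> R[i])
    (a_neq0 : exists i : nat, a i <> 0) (n : nat) (n_ge2 : (2 <= n)%N) :
  \prod_(i < n) mx22 (a (n - 1 - i)%N) 1 1 0 =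
  mx22 (Omega (segment a 0 n)).[1] (Omega (segment a 1 (n - 1))).[1]
       (Omega (segment a 0 (n - 1))).[1] (Omega (segment a 1 (n - 2))).[1].
Proof.
case: n n_ge2 => [|[|m]] // _.
by rewrite !Omega_continuant subn1 subn2 /= -prod_mx22_continuant.
Qed.
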